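(* For every integer $n\geq 1$ we have $\phi(n)\leq n$.
   Context: Let $A$ be a finite alphabet with at least two letters. A word $w\in A^*$ is rich if it contains exactly $|w|+1$ distinct palindromic factors (contiguous subwords), including the empty word $\epsilon$. Let $R$ be the set of all rich words over $A$. A rich word $w$ can be extended in at least two ways if there are two distinct letters $x,y\in A$ such that $wx,wy\in R$. For $w\in R$, let $K(w)$ be the set of all words $u\in A^*$ such that $wu\in R$ and $wu$ can be extended in at least two ways (so $\epsilon\in K(w)$ if $w$ can be extended in at least two ways). Let $\omega(w)=\min\{|u| \mid u\in K(w)\}$, and for $n>0$ let $\phi(n)=\max\{\omega(w)\mid w\in R,\ |w|=n\}$. *)

(* Defs.v *)
From mathcomp Require Import all_boot.

Set Implicit Arguments.
Unset Strict Implicit.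
Unset Printing Implicit Defensive.

Section RichWords.

Variable A : finType.
Implicit Types u v w : seq A.

Definition palindrome w : bool := rev w == w.

Definition factors w : seq (seq A) :=
  [seq take k (drop i w) | i <- iota 0 (size w).+1, k <- iota 0 (size w).+1].

Lemma mem_factors u w : (u \in factors w) = infix u w.
Proof.
apply/allpairsP/idP => [[[i k] /= [_ _ ->]]|/infixP [p [s ->]]].
  apply/infixP; exists (take i w), (drop k (drop i w)).
  by rewrite cat_take_drop cat_take_drop.
exists (size p, size u); split.
- by rewrite mem_iota /= add0n ltnS size_cat leq_addr.
- by rewrite mem_iota /= add0n ltnS !size_cat addnCA leq_addr.
- by rewrite /= drop_size_cat // take_size_cat.
Qed.

Definition pal_factors w : seq (seq A) := undup (filter palindrome (factors w)).

Definition rich w : bool := size (pal_factors w) == (size w).+1.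

Definition two_extendable w : Prop :=
  exists x y : A, [/\ x != y, rich (rcons w x) & rich (rcons w y)].

Definition K w u : Prop := rich (w ++ u) /\ two_extendable (w ++ u).

Definition is_min (S : nat -> Prop) (m : nat) : Prop :=
  S m /\ forall k, S k -> m <= k.

Definition is_max (S : nat -> Prop) (m : nat) : Prop :=
  S m /\ forall k, S k -> k <= m.

(* [min] and [max] are given as functional relations, because neither is
   defined a priori: [K w] could be empty. *)
Definition is_omega w (m : nat) : Prop :=
  is_min (fun k => exists2 u, K w u & size u = k) m.

(* The first conjunct keeps words whose omega is undefined from being silently
   left out of the maximum. *)
Definition is_phi (n m : nat) : Prop :=
  (forall w, rich w -> size w = n -> exists k, is_omega w k) /\
  is_max (fun k => exists w, [/\ rich w, size w = n & is_omega w k]) m.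

End RichWords.

Arguments is_phi A n m : clear implicits.

(* Main.v *)
(* A word is rich iff each prefix ends with a palindrome that is new in it. Writing a rich word as
   Q = v x p with p its longest proper palindromic suffix, x p occurs in Q only as a suffix, so Q x
   is rich ("forced letter"); forced letters lead to the palindromic closure v x p x rev(v). A word
   P with forced next letter also extends by another letter y as soon as P ends with y s for a
   palindrome s such that y s y is not a factor of P.
   Let w = v0 x0 p0 be rich of length n, with at least two letters, and let Z be w if w is a
   palindrome, and its closure otherwise.
   (1) If w is a palindrome or has a palindromic prefix longer than v0, then Z = U r with r its
   longest proper palindromic suffix and |U| <= n. Let g = v x p be the prefix of w before the last
   letter y that is not forced. Then x p x never occurs in the forced word U Z, while x p y recurs
   in it with period |U|, so some occurrence gives a branching point at length between n and 2n.
   (2) Otherwise let g = v x p be the last proper prefix of w with a palindromic suffix starting at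
   position at most |v0| + 1. The letter y after g is not forced, and |v| <= |v0|, so the mirror
   image y p x of the prefix occurrence of x p y ends in Z after w. As y p y does not occur in Z,
   there is a branching point after this y p. *)
Require Import Defs.
From mathcomp Require Import all_boot.
From mathcomp Require Import zify.

Set Implicit Arguments.
Unset Strict Implicit.
Unset Printing Implicit Defensive.

Section RichWordTheory.

Variable A : finType.
Implicit Types (u v w p q r s t P Q W Z : seq A) (x y z : A).

(* The carrier of a list may be presented as [Equality.sort] or as
   [Finite.sort], which [lia] does not identify. *)
Local Ltac slia :=
  repeat change (Equality.sort (fintype_Finite__to__eqtype_Equality A))
    with (Finite.sort A) in *; lia.

(** * Palindromic suffixes and a letter-by-letter criterion for richness *)

Lemma cat_eq_cat_split u v s t :
  u ++ v = s ++ t -> size u <= size s ->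
  exists r, s = u ++ r /\ v = r ++ t.
Proof.
move=> e le; exists (drop (size u) s).
have eu : take (size u) s = u by rewrite -(takel_cat t le) -e take_size_cat.
split; first by rewrite -{1}eu cat_take_drop.
apply/eqP; move/eqP: e; rewrite -{1}(cat_take_drop (size u) s) eu -catA.
by rewrite eqseq_cat // eqxx.
Qed.

Lemma palP w : reflect (rev w = w) (palindrome w).
Proof. exact: eqP. Qed.

Lemma pal_surround x p : palindrome (x :: rcons p x) = palindrome p.
Proof.
by rewrite /palindrome rev_cons rev_rcons /= eqseq_cons eqseq_rcons !eqxx andbT.
Qed.

Lemma prefix_pal_suffix s p :
  palindrome s -> palindrome p -> suffix p s = prefix p s.
Proof. by move=> /palP es /palP ep; rewrite -suffix_rev es ep. Qed.

Lemma mem_pal_factors u w : (u \in pal_factors w) = palindrome u && infix u w.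
Proof. by rewrite mem_undup mem_filter mem_factors. Qed.

Lemma suffix_le_suffix s r w :
  suffix s w -> suffix r w -> size s <= size r -> suffix s r.
Proof.
move=> /suffixP [a ->] /suffixP [b e] le.
have /(congr1 size) := e; rewrite !size_cat => esz.
have [|c [_ ->]] := cat_eq_cat_split (esym e); first by slia.
exact: suffix_suffix.
Qed.

(* A palindromic suffix that is new in [rcons w z] is a prefix, hence an
   earlier factor, as soon as it is shorter than another palindromic suffix. *)
Lemma new_pal_longest w z s r :
  palindrome s -> suffix s (rcons w z) -> ~~ infix s w ->
  palindrome r -> suffix r (rcons w z) -> size r <= size s.
Proof.
move=> ps ss ns pr sr; rewrite leqNgt; apply/negP => lt.
have := suffix_le_suffix ss sr (ltnW lt).
rewrite prefix_pal_suffix // => /prefixP [b eb].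
case/negP: ns; move/suffixP: sr => [a]; rewrite eb.
case/lastP: b eb => [|b y _]; first by rewrite cats0 => eb; rewrite eb ltnn in lt.
rewrite -!rcons_cat => /rcons_inj [-> _].
exact: infix_infix.
Qed.

(** Each of two new palindromic suffixes is at least as long as the other. Hence appending a letter
    creates at most one palindrome. *)
Lemma new_pal_unique w z s r :
  palindrome s -> suffix s (rcons w z) -> ~~ infix s w ->
  palindrome r -> suffix r (rcons w z) -> ~~ infix r w -> s = r.
Proof.
move=> ps ss ns pr sr nr.
have e : size s = size r.
  by apply/eqP; rewrite eqn_leq !(new_pal_longest ps ss, new_pal_longest pr sr).
move: (suffix_le_suffix ss sr); rewrite e leqnn => /(_ isT).
by rewrite suffixE e subnn drop0 => /eqP.
Qed.

Lemma size_pal_factors_new w z s :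
  palindrome s -> suffix s (rcons w z) -> ~~ infix s w ->
  size (pal_factors (rcons w z)) = (size (pal_factors w)).+1.
Proof.
move=> ps ss ns; apply/(perm_size (s2 := s :: pal_factors w))/uniq_perm.
- exact: undup_uniq.
- by rewrite /= mem_pal_factors negb_and ns orbT undup_uniq.
move=> u; rewrite inE !mem_pal_factors infix_rconsl.
case: eqP => [->|ne]; first by rewrite ps ss.
case pu : (palindrome u) => //=; case nu : (infix u w); rewrite ?orbT ?orbF //.
apply/negP => su; apply: ne.
by apply: (new_pal_unique pu su _ ps ss ns); rewrite nu.
Qed.

Lemma size_pal_factors_old w z :
  (forall s, palindrome s -> suffix s (rcons w z) -> infix s w) ->
  size (pal_factors (rcons w z)) = size (pal_factors w).
Proof.
move=> old; apply/perm_size/uniq_perm; try exact: undup_uniq.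
move=> u; rewrite !mem_pal_factors infix_rconsl.
case pu : (palindrome u) => //=; case su : (suffix u _) => //=.
by rewrite old.
Qed.

Definition new_pal w z s : Prop :=
  [/\ palindrome s, suffix s (rcons w z) & ~~ infix s w].

Lemma new_palP w z :
  (exists s, new_pal w z s) \/
  (forall s, palindrome s -> suffix s (rcons w z) -> infix s w).
Proof.
pose N s := palindrome s && ~~ infix s w.
pose S := [seq drop i (rcons w z) | i <- iota 0 (size w).+2].
case h : (has N S).
  left; move/hasP: h => [s /mapP [i _ ->] /andP [ps ns]].
  by exists (drop i (rcons w z)); split=> //; apply: suffix_drop.
right=> s ps ss; move/negbT/hasPn: h => /(_ s); rewrite /N ps /= negbK.
apply; apply/mapP; exists (size (rcons w z) - size s).
  by rewrite mem_iota size_rcons /= add0n ltnS leq_subr.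
by move: ss; rewrite suffixE => /eqP.
Qed.

Lemma size_pal_factors_le w : size (pal_factors w) <= (size w).+1.
Proof.
elim/last_ind: w => [|w z IH]; first by [].
case: (new_palP w z) => [[s [ps ss ns]]|old].
  by rewrite (size_pal_factors_new ps ss ns) size_rcons ltnS.
by rewrite size_pal_factors_old // size_rcons (leq_trans IH).
Qed.

(** As each letter adds at most one palindrome, the bound [size_pal_factors_le] is attained only if
    it is attained by every prefix. *)
Lemma rich_rcons w z :
  rich (rcons w z) <-> rich w /\ exists s, new_pal w z s.
Proof.
rewrite /rich size_rcons; split.
  case: (new_palP w z) => [[s [ps ss ns]]|old].
    by rewrite (size_pal_factors_new ps ss ns) eqSS => h; split=> //; exists s.
  rewrite size_pal_factors_old // => /eqP e.
  by have := size_pal_factors_le w; rewrite e ltnn.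
by case=> [/eqP e [s [ps ss ns]]]; rewrite (size_pal_factors_new ps ss ns) e.
Qed.

Lemma rich_catl u v : rich (u ++ v) -> rich u.
Proof.
elim/last_ind: v => [|v z IH]; first by rewrite cats0.
by rewrite -rcons_cat => /rich_rcons [/IH].
Qed.

(** The new palindromic suffix of [P] cannot fit inside [p], which occurs earlier, so it is longer;
    by symmetry [p] is also its prefix. *)
Lemma rich_return P p :
  rich P -> palindrome p -> suffix p P ->
  forall a b, P = a ++ p ++ b -> b <> [::] ->
  exists c l, [/\ P = c ++ l, palindrome l, size p < size l & prefix p l].
Proof.
case/lastP: P => [|P z].
  by move=> _ _ _ a [|x b] /(congr1 size) //; rewrite !size_cat /=; slia.
move=> /rich_rcons [_ [s [ps ss ns]]] pp sp a b.
case/lastP: b => // b y; rewrite -!rcons_cat => /rcons_inj [eP _] _.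
have lt : size p < size s.
  rewrite ltnNge; apply/negP => le; case/negP: ns.
  apply: infix_trans (suffixW (suffix_le_suffix ss sp le)) _.
  by rewrite eP infix_infix.
move/suffixP: (ss) => [c ec]; exists c, s; split=> //.
by rewrite -prefix_pal_suffix // (suffix_le_suffix sp ss) // ltnW.
Qed.

(** * Longest proper palindromic suffixes *)

(* [p] is the longest proper palindromic suffix of [v ++ x :: p]; the letter [x]
   in front of it is recorded because it is the forced next letter. *)
Definition lpps v x p : Prop :=
  palindrome p /\
  forall c l, v ++ x :: p = c ++ l -> c <> [::] -> palindrome l -> size l <= size p.

Lemma lpps_exists Q : Q <> [::] -> exists v x p, Q = v ++ x :: p /\ lpps v x p.
Proof.
case: Q => // a Q _.
pose N i := palindrome (drop i.+1 (a :: Q)).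
have exN : exists i, N i by exists (size Q); rewrite /N /= drop_size.
case: (ex_minnP exN) => i Ni mini.
have ltQ : i < size (a :: Q).
  by rewrite /= ltnS; apply: mini; rewrite /N /= drop_size.
exists (take i (a :: Q)), (nth a (a :: Q) i), (drop i.+1 (a :: Q)).
have e : a :: Q = take i (a :: Q) ++ nth a (a :: Q) i :: drop i.+1 (a :: Q).
  by rewrite -(drop_nth a ltQ) cat_take_drop.
split=> //; split=> // c l; rewrite -e => ec nc pl.
have : i <= (size c).-1.
  apply: mini; rewrite /N prednK; last by case: (c) nc.
  by rewrite ec drop_size_cat.
have := congr1 size ec; rewrite size_cat size_drop.
by case: (c) nc => //= _ c' _; slia.
Qed.

(* If [p] also occurs inside, then [v ++ x :: p] is itself a palindrome by
   [rich_return]; the first return of [p] to the prefix [p] is then a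
   palindromic prefix, hence a palindromic suffix longer than [p]. *)
Lemma lpps_occurrence v x p u s :
  rich (v ++ x :: p) -> lpps v x p -> v ++ x :: p = u ++ p ++ s ->
  u <> [::] -> s = [::].
Proof.
set Q := v ++ x :: p => rQ [pp mx] eQ nu.
case: (s =P [::]) => // ns.
have sp : suffix p Q by rewrite /Q -cat_rcons suffix_suffix.
have palQ : palindrome Q.
  have [c [l [ec pl lt _]]] := rich_return rQ pp sp eQ ns.
  case: c ec => [-> //|c0 c ec].
  by have := mx _ _ ec (fun e => match e with end) pl; rewrite leqNgt lt.
have preQ : prefix p Q by rewrite -prefix_pal_suffix.
pose N i := (0 < i) && prefix (take i Q ++ p) Q.
have exN : exists i, N i.
  exists (size u); rewrite /N lt0n size_eq0 (introN eqP nu) /=.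
  by rewrite eQ take_size_cat // catA prefix_prefix.
case: (ex_minnP exN) => i /andP [i0 /prefixP [s' es']] mini.
have iu : i <= size u.
  apply: mini; rewrite /N lt0n size_eq0 (introN eqP nu) /=.
  by rewrite eQ take_size_cat // catA prefix_prefix.
have szu : size (take i Q) = i.
  by rewrite size_takel // eQ size_cat; slia.
have ns' : 0 < size s'.
  have := congr1 size es'; rewrite {1}eQ !size_cat szu.
  by case: (s) ns => //= ? ? _; slia.
set P := take i Q ++ p in es'.
have rP : rich P by apply: (@rich_catl _ s'); rewrite -es'.
have [b eb] : exists b, P = p ++ b.
  by apply/prefixP; move/prefixP: preQ => [d ed]; apply/prefixP;
     have [|r [-> _]] := cat_eq_cat_split (etrans (esym ed) es');
     rewrite ?size_cat ?leq_addl //; exists r.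
have nb : b <> [::].
  by move=> b0; have := congr1 size eb; rewrite /P b0 !size_cat szu /=; slia.
have [c [l [ec pl lt prl]]] :=
  rich_return rP pp (suffix_suffix _ _) (a := [::]) eb nb.
(* [l] starts with [p] at position [size c], to the left of [i] because [l] is longer than [p];
   minimality of [i] leaves only position 0. *)
have c0 : c = [::].
  case: (posnP (size c)) => [/size0nil //|cp].
  have lec : size c <= size Q by rewrite es' ec !size_cat; slia.
  have : i <= size c.
    apply: mini; rewrite /N cp /= es' ec -catA take_size_cat //.
    by rewrite prefix_catr // eqxx; apply: prefix_catl.
  have := congr1 size ec; rewrite /P !size_cat szu; slia.
rewrite c0 /= in ec.
have palP' : palindrome P by rewrite ec.
have : suffix P Q.
  by rewrite prefix_pal_suffix // es' prefix_prefix.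
move=> /suffixP [d ed]; have : size P <= size p.
  apply: (mx d) => //; move=> d0.
  by have := congr1 size ed; rewrite es' d0 !size_cat /=; slia.
by rewrite ec leqNgt lt.
Qed.


(** An earlier [x p x] would contain an occurrence of [p] that is neither initial nor final. *)
Lemma lpps_new_pal v x p :
  rich (v ++ x :: p) -> lpps v x p ->
  new_pal (v ++ x :: p) x (x :: rcons p x).
Proof.
move=> rQ lQ; split; first by rewrite pal_surround; case: lQ.
  by rewrite rcons_cat rcons_cons suffix_suffix.
apply/infixP => -[a [b e]].
have e' : v ++ x :: p = rcons a x ++ p ++ x :: b.
  by rewrite e cat_rcons /= cat_rcons.
by have // : x :: b = [::]; apply: (lpps_occurrence rQ lQ e'); case: (a).
Qed.

(** * Forced letters and the palindromic closure *)

(* The letters of [W] from position [n] on are all forced. *)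
Definition standard n W : Prop :=
  forall P z s, W = P ++ z :: s -> n <= size P ->
  exists v p, P = v ++ z :: p /\ lpps v z p.

Lemma standard_catl n W s : standard n (W ++ s) -> standard n W.
Proof. by move=> st P z r e le; apply: (st P z (r ++ s)); rewrite // e -catA. Qed.

Lemma standard_trans n W s :
  standard n W -> standard (size W) (W ++ s) -> standard n (W ++ s).
Proof.
move=> st st' P z r e le; case: (leqP (size W) (size P)) => h.
  exact: st' e h.
have [|c [eW er]] := cat_eq_cat_split (esym e); first exact: ltnW.
case: c eW er => [|z' c] eW er; first by rewrite eW cats0 ltnn in h.
by case: er => <- _ in eW *; apply: st eW le.
Qed.

Lemma standard_cons n v x p s :
  lpps v x p -> n = size (v ++ x :: p) ->
  standard n.+1 ((v ++ x :: p) ++ x :: s) ->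
  standard n ((v ++ x :: p) ++ x :: s).
Proof.
move=> lQ en st P z r e; rewrite leq_eqVlt => /orP [/eqP sz|]; last exact: st e.
have [|c [eP ez]] := cat_eq_cat_split e; first by rewrite -en sz.
have c0 : c = [::].
  by apply: size0nil; have := congr1 size eP; rewrite size_cat; slia.
rewrite c0 cats0 /= in eP ez; case: ez => <- _.
by exists v, p.
Qed.

(** Once [x] is appended, [x p x] is the longest proper palindromic suffix, preceded by the last
    letter of [v]. Iterating consumes [v] from the right and writes [rev v]. *)
Lemma closure_standard v x p :
  rich (v ++ x :: p) -> lpps v x p ->
  rich ((v ++ x :: p) ++ x :: rev v) /\
  standard (size (v ++ x :: p)) ((v ++ x :: p) ++ x :: rev v).
Proof.
elim/last_ind: v x p => [|v y IH] x p rQ lQ.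
  have nQ := lpps_new_pal rQ lQ.
  rewrite cats1; split; first by apply/rich_rcons; split=> //; exists (x :: rcons p x).
  rewrite -cats1; apply: standard_cons => // P z s.
  by move=> /(congr1 size); rewrite !size_cat /=; slia.
have nQ := lpps_new_pal rQ lQ.
have rQ' : rich (v ++ y :: x :: rcons p x).
  rewrite -cat_rcons -rcons_cons -rcons_cat.
  by apply/rich_rcons; split=> //; exists (x :: rcons p x).
have lQ' : lpps v y (x :: rcons p x).
  case: nQ => ps ss ns; split=> // c l e _ pl.
  apply: (new_pal_longest ps ss ns pl).
  by rewrite rcons_cat rcons_cons cat_rcons e suffix_suffix.
have [r st] := IH _ _ rQ' lQ'.
have e : (v ++ y :: x :: rcons p x) ++ y :: rev v =
         (rcons v y ++ x :: p) ++ x :: rev (rcons v y).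
  by rewrite rev_rcons cat_rcons -!catA /= cat_rcons.
rewrite e in r st; split=> //; apply: standard_cons => //.
by move: st; rewrite -cat_rcons -rcons_cons -rcons_cat size_rcons.
Qed.

Lemma rich_cat_rcons P z s : rich (P ++ z :: s) -> rich (rcons P z).
Proof. by rewrite -cat_rcons; apply: rich_catl. Qed.

(** A first [x p x] would be completed by a forced letter, hence equal the new palindrome [z p' z].
    Then [p = p'], although [p] already occurred before [y], against [lpps_occurrence]. *)
Lemma standard_avoids_return v x p y t :
  let W := (v ++ x :: p) ++ y :: t in
  rich W -> lpps v x p -> y != x -> standard (size (v ++ x :: p)).+1 W ->
  ~~ infix (x :: rcons p x) W.
Proof.
move=> W; rewrite {}/W => rW lg nyx st.
have rg : rich (v ++ x :: p) by apply: rich_catl rW.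
have [pp _] := lg; have [pxpx _ ng] := lpps_new_pal rg lg.
elim/last_ind: t => [|t z IH] in rW st *.
  rewrite cats1 infix_rconsl negb_or ng andbT.
  by rewrite -rcons_cons suffix_rcons eq_sym (negbTE nyx).
have eW : (v ++ x :: p) ++ y :: rcons t z = rcons ((v ++ x :: p) ++ y :: t) z.
  by rewrite rcons_cat rcons_cons.
rewrite eW in rW st *; have [rQ _] := (rich_rcons _ _).1 rW.
have stQ : standard (size (v ++ x :: p)).+1 ((v ++ x :: p) ++ y :: t).
  by apply: (@standard_catl _ _ [:: z]); rewrite cats1.
have nQ := IH rQ stQ.
rewrite infix_rconsl negb_or nQ andbT; apply/negP => sx.
have [||v' [p' [eQ lQ]]] := st ((v ++ x :: p) ++ y :: t) z [::].
- by rewrite cats1.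
- by rewrite [X in _ <= X]size_cat /= addnS ltnS leq_addr.
have [pz sz nz] : new_pal ((v ++ x :: p) ++ y :: t) z (z :: rcons p' z).
  by rewrite eQ; apply: lpps_new_pal => //; rewrite -eQ.
have [ezx /rcons_inj [ep _]] := new_pal_unique pz sz nz pxpx sx nQ.
have e' : v' ++ z :: p' = rcons v x ++ p ++ y :: t.
  by rewrite -eQ cat_rcons -!catA.
rewrite eQ in rQ; rewrite -ep in e'.
by have // : y :: t = [::]; apply: (lpps_occurrence rQ lQ e'); case: (v).
Qed.


(** * Branching points and the periodic case *)

Lemma two_extendable_surround Q x y s :
  rich (rcons Q x) -> y != x -> palindrome s -> suffix (y :: s) Q ->
  ~~ infix (y :: rcons s y) Q -> two_extendable Q.
Proof.
move=> rQx nyx ps /suffixP [a eQ] nQ; exists y, x; split=> //.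
apply/rich_rcons; split; first by case/rich_rcons: rQx.
exists (y :: rcons s y); split=> //; first by rewrite pal_surround.
by rewrite eQ rcons_cat rcons_cons suffix_suffix.
Qed.

(** A forced letter already occurs in the prefix before it, so forced letters alone only prolong a
    power of one letter. *)
Lemma constant_or_last_deviation w :
  rich w -> w <> [::] ->
  (exists a, w = nseq (size w) a) \/
  exists v x p y t, [/\ w = (v ++ x :: p) ++ y :: t, lpps v x p, y != x &
                        standard (size (v ++ x :: p)).+1 w].
Proof.
elim/last_ind: w => // w z IH rwz _; case: (w =P [::]) => [->|/eqP nw].
  by left; exists z.
have rw : rich w by case/rich_rcons: rwz.
have [v [x [p [ew lw]]]] := lpps_exists (elimN eqP nw).
case: (z =P x) => [ezx|/eqP nzx]; last first.
  right; exists v, x, p, z, [::]; split=> //; first by rewrite -ew cats1.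
  by move=> P z' s /(congr1 size); rewrite -ew size_rcons !size_cat /=; slia.
case: (IH rw (elimN eqP nw)) => [[a ea]|].
  left; exists a; rewrite size_rcons -addn1 nseqD -ea cats1; congr rcons.
  have : x \in w by rewrite ew mem_cat inE eqxx orbT.
  by rewrite ezx {1}ea mem_nseq => /andP [_ /eqP].
case=> v' [x' [p' [y' [t' [ew' lg nyx st]]]]].
right; exists v', x', p', y', (rcons t' z); split=> //.
  by rewrite ew' rcons_cat rcons_cons.
rewrite -cats1; apply: standard_trans => //.
rewrite ezx {2}ew; apply: standard_cons => //; first by rewrite ew.
by rewrite -ew => P z' s /(congr1 size); rewrite !size_cat /=; slia.
Qed.

Lemma branch_periodic w e v1 x1 p1 v x p y t :
  let Z := v1 ++ x1 :: p1 in
  Z = w ++ e -> rich Z -> palindrome Z -> lpps v1 x1 p1 -> size v1 < size w ->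
  standard (size w) Z ->
  w = (v ++ x :: p) ++ y :: t -> lpps v x p -> y != x ->
  standard (size (v ++ x :: p)).+1 w ->
  exists u, K w u /\ size u <= size w.
Proof.
move=> Z eZ rZ palZ lZ ltv stZ ew lg nyx stw.
have [rW stW] := closure_standard rZ lZ.
set W := (v1 ++ x1 :: p1) ++ x1 :: rev v1 in rW stW.
have eW1 : W = w ++ e ++ x1 :: rev v1 by rewrite /W -/Z eZ catA.
(* As [Z] is a palindrome, its closure [W] also ends in [Z], shifted by the period
   [(size v1).+1]. *)
have eW2 : W = rcons v1 x1 ++ w ++ e.
  have [pp1 _] := lZ; rewrite -eZ /W -(palP _ palZ) /Z.
  by rewrite rev_cat rev_cons (palP _ pp1) cat_rcons -!catA /= cat_rcons.
have stWg : standard (size (v ++ x :: p)).+1 W.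
  apply: standard_trans stW; rewrite -/Z eZ; apply: standard_trans => //.
  by rewrite -eZ.
have avoid : ~~ infix (x :: rcons p x) W.
  move: rW stWg; rewrite eW1 ew -catA cat_cons => rW stWg.
  exact: standard_avoids_return.
(* The maximal [m] is the position of the final [y] in the last occurrence of [x p y] in [w]. *)
pose N m := (m < size w) && suffix (x :: rcons p y) (take m.+1 w).
have Nintro Q b : w = Q ++ y :: b -> suffix (x :: p) Q -> N (size Q).
  move=> eQ /suffixP [a ea]; rewrite /N eQ size_cat /= addnS ltnS leq_addr /=.
  rewrite -cat_rcons -(size_rcons Q y) take_size_cat //.
  by rewrite ea rcons_cat suffix_suffix.
have exN : exists m, N m.
  by exists (size (v ++ x :: p)); apply: (Nintro _ t); rewrite ?suffix_suffix.
have ubN m : N m -> m <= size w by case/andP => /ltnW.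
case: (ex_maxnP exN ubN) => m /andP [ltm /suffixP [a ea]] maxm.
have eQ : w = (a ++ x :: p) ++ y :: drop m.+1 w.
  by rewrite -cat_rcons rcons_cat -ea cat_take_drop.
set Q := a ++ x :: p in eQ; set b := drop _ _ in eQ.
have szQ : size Q = m.
  have := congr1 size ea; rewrite size_takel // /Q !size_cat /= size_rcons.
  by slia.
have eW3 : W = (rcons v1 x1 ++ Q) ++ y :: b ++ e.
  by rewrite eW2 eQ -!catA.
have sxp : suffix (x :: p) (rcons v1 x1 ++ Q).
  by rewrite suffix_catr // suffix_suffix.
(* If the shifted [y] still lay in [w], it would end a later [x p y] there. *)
have le : size w <= size (rcons v1 x1 ++ Q).
  rewrite leqNgt; apply/negP => lt.
  have [|[|y' r] [ewr er]] := cat_eq_cat_split (etrans (esym eW3) eW1).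
  - exact: ltnW.
  - by rewrite ewr cats0 ltnn in lt.
  case: er => eyy' _; rewrite -eyy' in ewr.
  have /maxm := Nintro _ _ ewr sxp.
  by rewrite size_cat size_rcons szQ; lia.
have [u [eu _]] := cat_eq_cat_split (etrans (esym eW1) eW3) le.
exists u; split; last first.
  have := congr1 size eu; rewrite 2!size_cat size_rcons szQ; slia.
split; first by rewrite -eu; apply: (@rich_catl _ (y :: b ++ e)); rewrite -eW3.
(* The roles are exchanged: [W] continues with [y], and [x] is the additional letter. *)
rewrite -eu; apply: (two_extendable_surround (x := y) (y := x) _ _ _ sxp).
- by apply: (@rich_cat_rcons _ _ (b ++ e)); rewrite -eW3.
- by rewrite eq_sym.
- by case: lg.
by apply: contra avoid => h; rewrite eW3 infix_catr.
Qed.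


(** * Branching inside the palindromic closure *)

Lemma closure_pal v x p :
  palindrome p -> palindrome ((v ++ x :: p) ++ x :: rev v).
Proof.
move=> /palP pp; apply/palP; rewrite rev_cat rev_cons revK rev_cat rev_cons pp.
by rewrite -catA /= !cat_rcons.
Qed.

(* [g] is the last proper prefix of [w] with a palindromic suffix starting at
   position at most [(size v0).+1]. After [g] the letter [y] deviates from the
   forced one, and up to [w] the palindrome [p] does not occur again, because
   its return would be a palindrome starting inside [g], too far to the left. *)
Lemma branch_in_closure v0 x0 p0 :
  let w := v0 ++ x0 :: p0 in
  rich w -> lpps v0 x0 p0 ->
  (forall G r, w = G ++ r -> palindrome G -> size G <= size v0) ->
  exists u, K w u /\ size u <= size w.
Proof.
move=> w rw lw noG.
have [rZ stZ] := closure_standard rw lw.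
have palZ := closure_pal v0 x0 (proj1 lw).
rewrite -/w in rZ stZ palZ; set Z := w ++ _ in rZ stZ palZ.
(* The empty suffix counts as a palindrome, so [C] holds for every word of length at most
   [(size v0).+1]. *)
pose C P := has (fun i => palindrome (drop i P)) (iota 0 (size v0).+2).
have Cintro P c l : P = c ++ l -> palindrome l -> size c <= (size v0).+1 -> C P.
  move=> eP pl le; apply/hasP; exists (size c); first by rewrite mem_iota.
  by rewrite eP drop_size_cat.
have szw : 1 < size w.
  rewrite ltnNge; apply/negP => le.
  have v00 : size v0 = 0.
    by move: le; rewrite /w size_cat /=; slia.
  have palw : palindrome w.
    by case: (w) le => [|a [|b w']] //= _; apply/palP.
  have := noG w [::] (esym (cats0 w)) palw.
  by rewrite v00 /w size_cat /= addnS.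
pose N m := [&& 0 < m, m < size w & C (take m w)].
have exN : exists m, N m.
  exists 1; rewrite /N szw /=; apply: (Cintro _ [::] (take 1 w)) => //.
  by case: (w) => [|a w'] /=; rewrite ?take0; apply/palP.
have ubN m : N m -> m <= size w by case/and3P => _ /ltnW.
case: (ex_maxnP exN ubN) => m /and3P [m0 ltm Cm] maxm.
have lastC P b : w = P ++ b -> b <> [::] -> C P -> size P <= m.
  move=> eP nb CP; case: (posnP (size P)) => [-> //|P0].
  apply: maxm; rewrite /N P0 eP take_size_cat // CP size_cat andbT /=.
  by case: (b) nb => //= *; rewrite addnS ltnS leq_addr.
have [y [t ew]] : exists y t, w = take m w ++ y :: t.
  have := cat_take_drop m w; case e : (drop m w) => [|y t] <-.
    by have := congr1 size e; rewrite size_drop /=; slia.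
  by exists y, t; rewrite take_size_cat // size_takel // ltnW.
have szg : size (take m w) = m by rewrite size_takel // ltnW.
have [|v [x [p [eg lg]]]] := @lpps_exists (take m w).
  by move/(congr1 size); rewrite szg; case: (m) m0.
rewrite eg in ew szg Cm; set g := v ++ x :: p in ew szg Cm.
have rg : rich g by apply: (@rich_catl _ (y :: t)); rewrite -ew.
have [pp mx] := lg.
have ltv : size v <= size v0.
  case/hasP: Cm => i; rewrite mem_iota add0n ltnS => /andP [_ le] pd.
  have egd := esym (cat_take_drop i g).
  case: (ltnP (size g) i) => [lti|lei].
    by move: lti; rewrite /g size_cat /=; slia.
  case: (posnP i) => [i0|ip].
    rewrite i0 drop0 in pd; have := noG _ _ ew pd.
    by rewrite /g size_cat /=; slia.
  have nt : take i g <> [::] by move/(congr1 size); rewrite size_takel //=; slia.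
  by have := mx _ _ egd nt pd; rewrite size_drop /g size_cat /=; slia.
(* Otherwise [x p x] ends [g x] and starts at [size v]: this contradicts the maximality of [m], or,
   if [g x] is all of [w], the choice of [p0] or [noG]. *)
have nyx : y != x.
  apply/eqP => eyx; rewrite eyx in ew.
  have egx : rcons g x = v ++ x :: rcons p x.
    by rewrite /g rcons_cat.
  have pxpx : palindrome (x :: rcons p x) by rewrite pal_surround.
  have CP : C (rcons g x) by apply: (Cintro _ _ _ egx pxpx); rewrite ltnW.
  case: t ew => [|z t] ew.
    rewrite cats1 egx in ew; have [_ mxw] := lw.
    case: (v) ew ltv => [|a v'] ew ltv.
      have := noG _ [::] _ pxpx; rewrite cats0 => /(_ ew).
      by have := congr1 size ew; rewrite /w size_cat /= size_rcons; slia.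
    have := mxw _ _ ew _ pxpx => /(_ (fun e => match e with end)).
    by move: ltv; have := congr1 size ew; rewrite /w !size_cat /= size_rcons; slia.
  have := lastC (rcons g x) (z :: t); rewrite cat_rcons => /(_ ew).
  by move=> /(_ (fun e => match e with end) CP); rewrite size_rcons szg ltnn.
have occ_g a b : g = a ++ p ++ b -> a <> [::] -> b = [::].
  exact: lpps_occurrence rg lg.
have pypy : palindrome (y :: rcons p y) by rewrite pal_surround.
have eZg : Z = g ++ y :: t ++ x0 :: rev v0 by rewrite /Z ew -catA.
have sz_v : size g = size v + (size p).+1 by rewrite /g size_cat.
have no_p P b : w = P ++ b -> b <> [::] -> size g < size P -> ~~ suffix p P.
  move=> eP nb ltP; apply/negP => sP.
  pose O i := (size g < i) && suffix p (take i w).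
  have exO : exists i, O i.
    by exists (size P); rewrite /O ltP eP take_size_cat.
  case: (ex_minnP exO) => i /andP [lti si] mini.
  have iP : i <= size P by apply: mini; rewrite /O ltP eP take_size_cat.
  have ltiw : i < size w.
    rewrite eP size_cat; case: (b) nb => //= *; slia.
  have szi : size (take i w) = i by rewrite size_takel // ltnW.
  have ri : rich (take i w) by apply: (@rich_catl _ (drop i w)); rewrite cat_take_drop.
  have [c0 [ei nc0]] : exists c0, take i w = g ++ c0 /\ c0 <> [::].
    have e := etrans (esym ew) (esym (cat_take_drop i w)).
    have [|c0 [ec _]] := cat_eq_cat_split e; first by rewrite szi ltnW.
    exists c0; split=> // c00; move: lti.
    by have := congr1 size ec; rewrite c00 cats0 szi => ->; rewrite ltnn.
  have ei' : take i w = rcons v x ++ p ++ c0 by rewrite ei cat_rcons -!catA.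
  have [c [l [ec pl lt /prefixP [l' el]]]] := rich_return ri pp si ei' nc0.
  have szc : size c + size l = i by rewrite -szi ec size_cat.
  (* The [p] that begins [l] ends before [i], so by minimality it ends within [g]; thus [l] starts
     at most at [(size v).+1]. *)
  have le : size c + size p <= size g.
    rewrite leqNgt; apply/negP => ltg.
    have : i <= size c + size p.
      apply: mini; rewrite /O ltg /=.
      have e : w = (c ++ p) ++ l' ++ drop i w.
        by rewrite -{1}(cat_take_drop i w) ec el -!catA.
      by rewrite e -size_cat take_size_cat // suffix_suffix.
    by slia.
  have : size (take i w) <= m.
    apply: (lastC _ (drop i w)); rewrite ?cat_take_drop //.
      by move/(congr1 size); rewrite size_drop /=; slia.
    by apply: (Cintro _ _ _ ec pl); slia.
  by rewrite szi -szg; slia.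
have avoid P s : Z = P ++ s -> ~~ infix (y :: rcons p y) P.
  elim/last_ind: P s => [|R z IH] s; first by [].
  rewrite cat_rcons => eZ; have nR := IH _ eZ.
  rewrite infix_rconsl negb_or nR andbT; apply/negP => sy.
  have rR : rich R by apply: (@rich_catl _ (z :: s)); rewrite -eZ.
  have ezy : z = y /\ suffix (y :: p) R.
    by move: sy; rewrite -rcons_cons suffix_rcons => /andP [/eqP ->].
  case: ezy => ezy /suffixP [a ea]; rewrite ezy in eZ sy.
  (* A first [y p y] is excluded by [occ_g] inside [g], by [no_p] up to [w], and by forcedness
     beyond [w]; just after [g] it would need [x = y]. *)
  case: (ltngtP (size R) (size g)) => [lt|gt|e].
  - have [|[|z' c] [eg' _]] := cat_eq_cat_split (etrans (esym eZ) eZg).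
    + exact: ltnW.
    + by rewrite eg' cats0 ltnn in lt.
    have // : z' :: c = [::]; apply: (occ_g (rcons a y)); last by case: (a).
    by rewrite eg' ea cat_rcons -!catA.
  - case: (ltnP (size R) (size w)) => [ltw|gew].
      have [|[|z' c] [ew' _]] := cat_eq_cat_split (esym eZ : R ++ _ = w ++ _).
      + exact: ltnW.
      + by rewrite ew' cats0 ltnn in ltw.
      have := no_p _ _ ew' (fun e => match e with end) gt.
      by rewrite ea -cat_rcons suffix_suffix.
    have [v' [p' [eR lR]]] := stZ _ _ _ eZ gew.
    have [pz sz nz] : new_pal R y (y :: rcons p' y).
      by rewrite eR; apply: lpps_new_pal => //; rewrite -eR.
    have [/rcons_inj [ep]] := new_pal_unique pz sz nz pypy sy nR.
    have [|[|z' c] [eRg _]] := cat_eq_cat_split (etrans (esym eZg) eZ).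
    + exact: ltnW.
    + by rewrite eRg cats0 ltnn in gt.
    rewrite eR ep in rR lR eRg; have // : z' :: c = [::].
    apply: (lpps_occurrence rR lR (u := rcons v x)); last by case: (v).
    by rewrite eRg cat_rcons -!catA.
  - have [|c [eg' _]] := cat_eq_cat_split (etrans (esym eZ) eZg); first by rewrite e.
    have c0 : c = [::].
      by apply: size0nil; have := congr1 size eg'; rewrite size_cat e; slia.
    move: eg'; rewrite c0 cats0 ea /g => /eqP.
    rewrite -!cat_rcons eqseq_cat; last first.
      by move: e; rewrite ea /g !size_cat !size_rcons /=; slia.
    by rewrite eqseq_rcons [x == y]eq_sym (negbTE nyx) andbF.
(* Reversing [Z] turns its prefix [g y] into the suffix [y p x (rev v)]; [Q] stops before this [x],
   so [u] has length [size v0 - size v]. *)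
pose Q := rev (t ++ x0 :: rev v0) ++ y :: p.
have eZQ : Z = Q ++ x :: rev v.
  have rg' : rev g = p ++ x :: rev v.
    by rewrite rev_cat rev_cons (palP _ pp) cat_rcons.
  by rewrite -(palP _ palZ) eZg rev_cat rg' rev_cons cat_rcons /Q -catA.
have leQ : size w <= size Q.
  by have := congr1 size eZQ; rewrite /Z !size_cat /= !size_rev; slia.
have [u [eu _]] := cat_eq_cat_split (eZQ : w ++ _ = Q ++ _) leQ.
exists u; split; last first.
  have := congr1 size eZQ; rewrite {1}/Z eu !size_cat /= !size_rev.
  by slia.
split; first by rewrite -eu; apply: (@rich_catl _ (x :: rev v)); rewrite -eZQ.
rewrite -eu; apply: (two_extendable_surround (x := x) (y := y) _ nyx pp).
- by apply: (@rich_cat_rcons _ _ (rev v)); rewrite -eZQ.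
- exact: suffix_suffix.
exact: avoid eZQ.
Qed.

(** * Assembling the cases *)

Lemma rich_nseq n (a : A) : rich (nseq n a).
Proof.
elim: n => // n IH; have e : nseq n.+1 a = rcons (nseq n a) a.
  by rewrite -cats1 -addn1 nseqD.
rewrite e; apply/rich_rcons; split=> //; exists (nseq n.+1 a); split.
- by apply/palP; rewrite rev_nseq.
- by rewrite e suffix_refl.
by apply/negP => /size_infix; rewrite !size_nseq ltnn.
Qed.

Lemma rich_branch w :
  rich w -> w <> [::] -> 1 < #|A| -> exists u, K w u /\ size u <= size w.
Proof.
move=> rw nw cA; have [[a ea]|] := constant_or_last_deviation rw nw.
  have [b nba] : exists b, b != a.
    have /card_gt0P [b] : 0 < #|predC1 a| by have := cardC1 a; lia.
    by exists b.
  exists [::]; split=> //; split; rewrite cats0 //; exists a, b; split.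
  - by rewrite eq_sym.
  - have -> : rcons w a = nseq (size w).+1 a.
      by rewrite -addn1 nseqD -ea cats1.
    exact: rich_nseq.
  apply/rich_rcons; split=> //; exists [:: b]; split=> //; first exact/palP.
    by rewrite -cats1 suffix_suffix.
  by rewrite infix1s ea mem_nseq (negbTE nba) andbF.
case=> v [x [p [y [t [ew lg nyx st]]]]].
have [v0 [x0 [p0 [ew0 lw]]]] := lpps_exists nw.
have szw0 : size w = size v0 + (size p0).+1 by rewrite ew0 size_cat.
case pw : (palindrome w).
  apply: (branch_periodic (w := w) (e := [::]) (v1 := v0) (x1 := x0) (p1 := p0)
    _ _ _ _ _ _ ew lg nyx st); rewrite -?ew0 ?cats0 //; first by rewrite szw0; lia.
  by move=> P z s /(congr1 size); rewrite size_cat /=; slia.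
case h : (has (fun i => palindrome (take i w)) (iota (size v0).+1 (size w - size v0))); last first.
  rewrite ew0 in rw *; apply: branch_in_closure => // G r e pG.
  rewrite leqNgt; apply/negP => lt; move/negbT/hasPn: h => /(_ (size G)).
  rewrite mem_iota {2}ew0 e take_size_cat // pG lt /= => /(_ _)/negP[] //.
  by rewrite szw0; have := congr1 size e; rewrite !size_cat /=; slia.
case/hasP: h => i; rewrite mem_iota => /andP [lti lei] pG.
have leiw : i <= size w by rewrite szw0 in lei *; slia.
rewrite ew0 in rw; have [rZ stZ] := closure_standard rw lw.
have palZ := closure_pal v0 x0 (proj1 lw).
rewrite -ew0 in rw rZ stZ palZ; set Z := w ++ _ in rZ stZ palZ.
have [|v1 [x1 [p1 [eZ lZ]]]] := @lpps_exists Z; first by rewrite /Z; case: (w) nw.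
have szZ : size Z = size w + (size v0).+1 by rewrite /Z size_cat /= size_rev.
(* The palindromic prefix of length [i > size v0] is also a suffix of the palindrome [Z], so [p1] is
   at least that long. *)
have lt1 : size v1 < size w.
  have : suffix (take i w) Z.
    rewrite prefix_pal_suffix // /Z.
    by apply: prefix_catl; apply: prefix_take.
  move=> /suffixP [c ec]; have szc := congr1 size ec.
  rewrite size_cat szZ size_takel // in szc.
  have nc : c <> [::] by move=> c0; rewrite c0 /= in szc; slia.
  have := proj2 lZ c (take i w); rewrite -eZ => /(_ ec nc pG).
  have := congr1 size eZ; rewrite szZ size_cat size_takel //=; slia.
apply: (branch_periodic (w := w) (e := x0 :: rev v0) (v1 := v1) (x1 := x1)
  (p1 := p1) _ _ _ _ _ _ ew lg nyx st); rewrite -?eZ //.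
Qed.

(** * Existence of the minimum and the maximum by finite search *)

Definition two_extendableb w : bool :=
  [exists x, exists y, [&& x != y, rich (rcons w x) & rich (rcons w y)]].

Lemma two_extendableP w : reflect (two_extendable w) (two_extendableb w).
Proof.
apply: (iffP existsP) => [[x /existsP [y /and3P []]]|[x [y [? ? ?]]]].
  by exists x, y.
by exists x; apply/existsP; exists y; apply/and3P.
Qed.

Definition K_size w k : bool :=
  [exists u : k.-tuple A, rich (w ++ u) && two_extendableb (w ++ u)].

Lemma K_sizeP w k : reflect (exists2 u, K w u & size u = k) (K_size w k).
Proof.
apply: (iffP existsP) => [[u /andP [ru /two_extendableP eu]]|[u [ru eu] su]].
  by exists u; rewrite ?size_tuple.
move/eqP: su => su; exists (Tuple su); rewrite ru.
exact/two_extendableP.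
Qed.

Definition is_omegab w m : bool := K_size w m && [forall k : 'I_m, ~~ K_size w k].

Lemma is_omegaP w m : reflect (is_omega w m) (is_omegab w m).
Proof.
apply: (iffP andP) => [[/K_sizeP Km /forallP nK]|[/K_sizeP Km mK]]; split=> //.
  move=> k /K_sizeP Kk; rewrite leqNgt; apply/negP => ltk.
  by have := nK (Ordinal ltk); rewrite Kk.
by apply/forallP => k; apply/negP => /K_sizeP /mK; rewrite leqNgt ltn_ord.
Qed.

Lemma omega_exists w :
  rich w -> w <> [::] -> 1 < #|A| -> exists2 m, is_omega w m & m <= size w.
Proof.
move=> rw nw cA; have [u [Ku le]] := rich_branch rw nw cA.
have exK : exists k, K_size w k by exists (size u); apply/K_sizeP; exists u.
case: (ex_minnP exK) => m /K_sizeP Km minm.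
exists m; first by split=> // k /K_sizeP; apply: minm.
by apply: leq_trans le; apply: minm; apply/K_sizeP; exists u.
Qed.

Lemma is_omega_unique w k m : is_omega w k -> is_omega w m -> k = m.
Proof.
by move=> [Kk mk] [Km mm]; apply/eqP; rewrite eqn_leq mk ?mm.
Qed.

End RichWordTheory.

Theorem corollary4p9 (A : finType) (hA : 2 <= #|A|) (n : nat) (hn : 1 <= n) :
  exists m : nat, is_phi A n m /\ m <= n.
Proof.
have nonempty (w : seq A) : size w = n -> w <> [::].
  by move=> sw w0; rewrite -sw w0 in hn.
pose S k := [exists w : n.-tuple A, rich w && is_omegab w k].
have SP k : reflect (exists w, [/\ rich w, size w = n & is_omega (A := A) w k]) (S k).
  apply: (iffP existsP) => [[w /andP [rw /is_omegaP ow]]|[w [rw sw /is_omegaP ow]]].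
    by exists w; rewrite size_tuple.
  by move/eqP: sw => sw; exists (Tuple sw); rewrite rw.
have le_n k : S k -> k <= n.
  move=> /SP [w [rw sw ok]].
  have [m om] := omega_exists rw (nonempty w sw) hA.
  by rewrite sw (is_omega_unique ok om).
have exS : exists k, S k.
  have /card_gt0P [a _] : 0 < #|A| by apply: leq_trans hA.
  have sz := size_nseq n a.
  have [m om _] := omega_exists (rich_nseq n a) (nonempty _ sz) hA.
  by exists m; apply/SP; exists (nseq n a); split=> //; apply: rich_nseq.
case: (ex_maxnP exS le_n) => m Sm maxm; exists m; split; last exact: le_n.
split=> [w rw sw|].
  by have [k ok _] := omega_exists rw (nonempty w sw) hA; exists k.
by split=> [|k /SP /maxm]; first exact/SP.
Qed.
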